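(* Let $K$ be a field and let $P \subset \mathbb{R}^d$ be a lattice polytope such that every edge of $P$ is primitive. If the toric ideal $I_P$ is quadratic, then every clique of the $1$-skeleton $\mathrm{sk}(P)$ is the vertex set of a face of $P$.
   Context: A lattice polytope in $\mathbb{R}^d$ is a convex polytope all of whose vertices lie in $\mathbb{Z}^d$. A segment with endpoints in $\mathbb{Z}^d$ is primitive if its only lattice points are its two endpoints. The $1$-skeleton $\mathrm{sk}(P)$ is the finite simple graph whose vertices are the vertices of $P$, with two distinct vertices $v,w$ adjacent iff $\mathrm{conv}(\{v,w\})$ is an edge ($1$-dimensional face) of $P$. A clique of a graph is the vertex set of a complete subgraph. $P$ itself is regarded as a face of $P$. Let $P \cap \mathbb{Z}^d = \{\mathbf{a}_1,\dots,\mathbf{a}_n\}$ (distinct points). The toric ideal $I_P$ is the kernel of the $K$-algebra homomorphism $\pi : K[x_1,\dots,x_n] \to K[t_1^{\pm1},\dots,t_d^{\pm 1},s]$, $\pi(x_i)=\mathbf{t}^{\mathbf{a}_i}s$, where $\mathbf{t}^{\mathbf{a}}=t_1^{a_1}\cdots t_d^{a_d}$ for $\mathbf{a}=(a_1,\dots,a_d)$. A binomial is a difference of two distinct monomials (each with coefficient $1$). $I_P$ is called quadratic if it is generated by quadratic (homogeneous of degree $2$) binomials; the zero ideal counts as quadratic (empty generating set). *)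

(* Defs.v *)
From HB Require Import structures.
From mathcomp Require Import all_boot all_order all_algebra.
From mathcomp Require Import boolp classical_sets reals.
From mathcomp Require Import mpoly.

Set Implicit Arguments.
Unset Strict Implicit.
Unset Printing Implicit Defensive.

Import GRing.Theory Num.Theory.

Local Open Scope classical_set_scope.
Local Open Scope ring_scope.

Section Polytopes.
Context {R : realType} {d : nat}.
Implicit Types (A P F E C : set 'rV[R]_d) (x v w : 'rV[R]_d).

Definition conv A : set 'rV[R]_d :=
  [set x | exists n (p : 'I_n -> 'rV[R]_d) (c : 'I_n -> R),
    [/\ forall i, A (p i), forall i, 0 <= c i, \sum_i c i = 1
      & x = \sum_i c i *: p i]].

Definition polytope P := exists s : seq 'rV[R]_d, P = conv [set` s].

(* Taking u = 0 is allowed: P itself (b = 0) and the empty set (b = 1) are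
   faces of P. *)
Definition face P F := exists (u : 'rV[R]_d) (b : R),
  (forall x, P x -> \sum_j u 0 j * x 0 j <= b) /\
  F = [set x | P x /\ \sum_j u 0 j * x 0 j = b].

Definition affinely_independent m (p : 'I_m.+1 -> 'rV[R]_d) : bool :=
  row_free (\matrix_(i < m) (p (lift ord0 i) - p ord0)).

Definition has_dim A (k : nat) :=
  (exists p : 'I_k.+1 -> 'rV[R]_d,
     (forall i, A (p i)) /\ affinely_independent p) /\
  (forall m (p : 'I_m.+1 -> 'rV[R]_d),
     (forall i, A (p i)) -> affinely_independent p -> (m <= k)%N).

Definition vertices P : set 'rV[R]_d := [set v | face P [set v]].

Definition edge P E := face P E /\ has_dim E 1.

Definition lattice_pt (z : 'rV[int]_d) : 'rV[R]_d := map_mx intr z.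

Definition lattice_points A : set 'rV[int]_d := [set z | A (lattice_pt z)].

Definition lattice_polytope P :=
  polytope P /\ forall v, vertices P v -> exists z, v = lattice_pt z.

Definition primitive_segment A := exists y z : 'rV[int]_d,
  [/\ y <> z, A = conv [set lattice_pt y; lattice_pt z]
    & lattice_points A = [set y; z]].

Definition sk_adj P v w :=
  [/\ vertices P v, vertices P w, v <> w & edge P (conv [set v; w])].

Definition sk_clique P C :=
  C `<=` vertices P /\ (forall v w, C v -> C w -> v <> w -> sk_adj P v w).

End Polytopes.

(* The Laurent polynomial ring K[t_1^{+-1}, ..., t_d^{+-1}, s], as the subring
   of the field of rational functions in d + 1 variables formed by the
   fractions whose denominator is a power of t_1 ... t_d. The variable s is
   the last one. *)
Section Laurent.
Variables (K : fieldType) (d : nat).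

Local Notation "x %:F" := (@FracField.tofrac _ x).
Local Notation ratfun := {fraction {mpoly K[d.+1]}}.

Definition ratT (j : 'I_d) : ratfun := ('X_(widen_ord (leqnSn d) j))%:F.
Definition ratS : ratfun := ('X_ord_max)%:F.

Definition laurent_pred : {pred ratfun} :=
  fun x => `[< exists (p : {mpoly K[d.+1]}) (k : nat),
                 x = p%:F / (\prod_j ratT j) ^+ k >].

Lemma laurent_predP x :
  reflect (exists p k, x = p%:F / (\prod_j ratT j) ^+ k) (x \in laurent_pred).
Proof. exact: asboolP. Qed.

Lemma ratT_neq0 j : ratT j != 0.
Proof. by rewrite /ratT tofrac_eq0 -msupp_eq0 msuppX. Qed.

Lemma prod_ratT_neq0 : \prod_j ratT j != 0.
Proof. by apply/prodf_neq0 => j _; exact: ratT_neq0. Qed.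

Lemma prod_ratTE :
  \prod_j ratT j = (\prod_(j < d) 'X_(widen_ord (leqnSn d) j))%:F.
Proof. by rewrite rmorph_prod. Qed.

Lemma laurent_tofrac (p : {mpoly K[d.+1]}) : p%:F \in laurent_pred.
Proof. by apply/laurent_predP; exists p, 0%N; rewrite expr0 divr1. Qed.

Lemma laurent_subring : subring_closed laurent_pred.
Proof.
have T0 k : (\prod_j ratT j) ^+ k != 0 by rewrite expf_neq0 ?prod_ratT_neq0.
split; first by rewrite -tofrac1 laurent_tofrac.
  move=> _ _ /laurent_predP[p [k ->]] /laurent_predP[q [l ->]].
  pose D := \prod_(j < d) 'X_(widen_ord (leqnSn d) j) : {mpoly K[d.+1]}.
  apply/laurent_predP; exists (p * D ^+ l - q * D ^+ k), (k + l)%N.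
  rewrite -mulNr.
  rewrite addf_div; [|exact: T0|exact: T0].
  by rewrite tofracB !tofracM !tofracXn -prod_ratTE exprD mulNr.
move=> _ _ /laurent_predP[p [k ->]] /laurent_predP[q [l ->]].
by apply/laurent_predP; exists (p * q), (k + l)%N; rewrite mulf_div exprD rmorphM.
Qed.

HB.instance Definition _ :=
  GRing.isSubringClosed.Build ratfun laurent_pred laurent_subring.

Lemma laurent_ratT_exp j (z : int) : ratT j ^ z \in laurent_pred.
Proof.
have Tj : ratT j \in laurent_pred by exact: laurent_tofrac.
case: z => k; first exact: rpredX.
rewrite /exprz -exprVn rpredX //; apply/laurent_predP.
exists (\prod_(i < d | i != j) 'X_(widen_ord (leqnSn d) i)), 1%N.
rewrite expr1 rmorph_prod -/(ratT _) [X in _ = _ / X](bigD1 j) //=.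
rewrite invfM mulrCA divff ?mulr1 //.
by apply/prodf_neq0 => i _; exact: ratT_neq0.
Qed.

Record laurent := Laurent {
  laurent_val :> ratfun;
  laurent_valP : laurent_val \in laurent_pred }.

HB.instance Definition _ := [isSub for laurent_val].
HB.instance Definition _ := [Choice of laurent by <:].
HB.instance Definition _ :=
  [SubChoice_isSubComNzRing of laurent by <:].

Definition laurentC (c : K) : laurent := Laurent (laurent_tofrac c%:MP).

Lemma laurentC_is_zmod_morphism : zmod_morphism laurentC.
Proof. by move=> x y; apply/val_inj; rewrite /= !rmorphB. Qed.

Lemma laurentC_is_monoid_morphism : monoid_morphism laurentC.
Proof.
by split=> [|x y]; apply/val_inj; rewrite /= ?rmorph1 // !rmorphM.
Qed.

HB.instance Definition _ :=
  GRing.isZmodMorphism.Build K laurent laurentC laurentC_is_zmod_morphism.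
HB.instance Definition _ :=
  GRing.isMonoidMorphism.Build K laurent laurentC laurentC_is_monoid_morphism.

Lemma toric_monomial_subproof (z : 'rV[int]_d) :
  (\prod_j ratT j ^ z 0 j) * ratS \in laurent_pred.
Proof.
by rewrite rpredM ?laurent_tofrac // rpred_prod // => j _; exact: laurent_ratT_exp.
Qed.

Definition toric_monomial (z : 'rV[int]_d) : laurent :=
  Laurent (toric_monomial_subproof z).

End Laurent.

Definition toric_map (K : fieldType) (d n : nat) (a : 'I_n -> 'rV[int]_d)
    (p : {mpoly K[n]}) : laurent K d :=
  mmap (@laurentC K d) (fun i => toric_monomial K (a i)) p.

Definition toric_ideal (K : fieldType) (d n : nat) (a : 'I_n -> 'rV[int]_d) :
    set {mpoly K[n]} :=
  [set p | toric_map a p = 0].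
Arguments toric_ideal K {d n} a.

Definition ideal_span (A : comNzRingType) (G : set A) : set A :=
  [set p | exists k (c g : 'I_k -> A),
    (forall i, G (g i)) /\ p = \sum_i c i * g i].

Definition binomial (K : fieldType) (n : nat) (p : {mpoly K[n]}) :=
  exists m1 m2 : 'X_{1..n}, m1 <> m2 /\ p = 'X_[m1] - 'X_[m2].

Definition quadratic_ideal (K : fieldType) (n : nat) (I : set {mpoly K[n]}) :=
  exists G : set {mpoly K[n]},
    (forall g, G g -> binomial g /\ g \is 2.-homog) /\ I = ideal_span G.

(* Main.v *)
Require Import Defs.
From mathcomp Require Import all_boot all_order all_algebra.
From mathcomp Require Import boolp classical_sets reals.
From mathcomp Require Import mpoly.
From mathcomp Require Import ring lra zify.

Set Implicit Arguments.
Unset Strict Implicit.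
Unset Printing Implicit Defensive.

Import Order.TTheory GRing.Theory Num.Theory.

Local Open Scope classical_set_scope.
Local Open Scope ring_scope.

(** Suppose that the monomial x^m is supported on a clique C of the skeleton.
    A quadratic binomial x^m1 - x^m2 of the toric ideal with x^m1 dividing x^m
    would give lattice points of P with a_i + a_j = a_k + a_l and a_i, a_j in
    C.  If i = j this is a vertex, otherwise the segment [a_i, a_j] is an edge;
    in both cases it is a face, so it contains a_k and a_l, and by primitivity
    these are a_i and a_j again: m1 = m2 ([edge_sum_unique]).  Since quadratic
    binomials generate the ideal, no element of the ideal has x^m among its
    monomials ([quadratic_ideal_coeff0]).

    Now let w be a lattice point of P outside C.  By Farkas' lemma over the
    rationals, either some affine functional is maximal on P along all of C but
    not at w, or, with every point extended by a last coordinate 1, some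
    nonnegative multiple of the sum of C is w plus a nonnegative combination of
    the lattice points of P ([separate_or_relation]).  In the second case,
    clearing denominators gives monomials x^m and x^m' of equal degree and equal
    exponent sum, the first supported on C and the second divisible by x_w.
    Then x^m - x^m' is in the toric ideal and involves x^m, which is impossible.
    So there is a functional for every w; their sum is maximal on P exactly
    along the face whose lattice points are those in C.

    That the vertices of this face are the points of C uses that P is the
    convex hull of its vertices ([polytope_vertices]), hence of its lattice
    points. *)

(** * The standard bilinear form *)

Section Dot.
Context {F : comNzRingType} {d : nat}.
Implicit Types u x : 'rV[F]_d.

Definition dot u x : F := \sum_j u 0 j * x 0 j.

Lemma dotC u x : dot u x = dot x u.
Proof. by apply: eq_bigr => j _; rewrite mulrC. Qed.

Lemma dotDr u x y : dot u (x + y) = dot u x + dot u y.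
Proof. by rewrite -big_split; apply: eq_bigr => j _; rewrite mxE mulrDr. Qed.

Lemma dotZr c u x : dot u (c *: x) = c * dot u x.
Proof. by rewrite mulr_sumr; apply: eq_bigr => j _; rewrite mxE mulrCA. Qed.

Lemma dotNr u x : dot u (- x) = - dot u x.
Proof. by rewrite -scaleN1r dotZr mulN1r. Qed.

Lemma dotr0 u : dot u 0 = 0.
Proof. by rewrite -(scale0r 0) dotZr mul0r. Qed.

Lemma dot_sumr (I : finType) (p : I -> 'rV[F]_d) u :
  dot u (\sum_i p i) = \sum_i dot u (p i).
Proof. exact: (big_morph (dot u) (dotDr u) (dotr0 u)). Qed.

Lemma dot_suml (I : finType) (p : I -> 'rV[F]_d) x :
  dot (\sum_i p i) x = \sum_i dot (p i) x.
Proof. by rewrite dotC dot_sumr; apply: eq_bigr => i _; rewrite dotC. Qed.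

End Dot.

Lemma dot_row_mx (F : comNzRingType) d1 d2 (u x : 'rV[F]_d1) (v y : 'rV[F]_d2) :
  dot (row_mx u v) (row_mx x y) = dot u x + dot v y.
Proof.
by rewrite /dot big_split_ord; congr (_ + _); apply: eq_bigr => j _;
  rewrite ?row_mxEl ?row_mxEr.
Qed.

(** * Farkas' lemma *)

Section Farkas.
Context {F : realFieldType} {d : nat}.
Implicit Types (a p : 'rV[F]_d).

(** Bartl's induction, valid over any ordered field.  If the inequality on [g]
    does not already follow from all the [a i] but the first, a point [x1] that
    witnesses this is used to project everything onto the kernel of the first
    functional, where the induction hypothesis applies. *)
Lemma farkas m (a : 'I_m -> 'rV[F]_d) (g : 'rV[F]_d) :
  (forall x, (forall i, dot (a i) x <= 0) -> dot g x <= 0) ->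
  exists2 c : 'I_m -> F, forall i, 0 <= c i & g = \sum_i c i *: a i.
Proof.
elim: m a g => [|m IHm] a g.
  move=> /(_ g) g_le0; exists (fun=> 0) => //; rewrite big_ord0.
  have sq_ge0 j : true -> 0 <= g 0 j * g 0 j by rewrite -expr2 sqr_ge0.
  have /eqP : dot g g = 0.
    by apply: le_anti; rewrite g_le0 ?sumr_ge0 //; case.
  rewrite psumr_eq0 // => /allP g0; apply/rowP => j; rewrite mxE.
  by apply/eqP; have := g0 j; rewrite mem_index_enum mulf_eq0 orbb => /(_ isT).
move=> a_imp_g; pose b i := a (lift ord0 i).
have [b_imp_g|] := pselect (forall x, (forall i, dot (b i) x <= 0) -> dot g x <= 0).
  have [c c_ge0 ->] := IHm b g b_imp_g.
  exists (fun i => oapp c 0 (unlift ord0 i)) => [i|]; first by case: unlift.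
  rewrite big_ord_recl unlift_none scale0r add0r.
  by apply: eq_bigr => i _; rewrite liftK.
move=> /existsNP[x0 /not_implyP[b_x0 /negP]]; rewrite -ltNge => g_x0.
have a0_x0 : 0 < dot (a ord0) x0.
  rewrite ltNge; apply: contraL g_x0 => a0_x0; rewrite -leNgt.
  by apply: a_imp_g => i; case: (unliftP ord0 i) => [k ->|->] //; exact: b_x0.
(* Normalized so that [x - dot (a ord0) x *: x1] is in the kernel of [a ord0]. *)
pose x1 := (dot (a ord0) x0)^-1 *: x0.
have a0_x1 : dot (a ord0) x1 = 1 by rewrite dotZr mulVf ?gt_eqF.
have b_x1 i : dot (b i) x1 <= 0.
  by rewrite dotZr mulr_ge0_le0 ?invr_ge0 ?(ltW a0_x0).
have g_x1 : 0 <= dot g x1 by rewrite dotZr mulr_ge0 ?invr_ge0 ?ltW.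
pose proj v := v - dot v x1 *: a ord0.
have dot_proj v x : dot (proj v) x = dot v (x - dot (a ord0) x *: x1).
  rewrite dotC dotDr dotNr dotZr dotDr dotNr dotZr dotC (dotC x (a _)); ring.
have [c c_ge0 cE] : exists2 c : 'I_m -> F,
    forall i, 0 <= c i & proj g = \sum_i c i *: proj (b i).
  apply: IHm => x proj_x; rewrite dot_proj; apply: a_imp_g => i.
  case: (unliftP ord0 i) => [k ->|->]; first by rewrite -dot_proj proj_x.
  by rewrite dotDr dotNr dotZr a0_x1 mulr1 subrr.
(* The coefficient of [a ord0] left after expanding the projections in [cE]. *)
pose c0 := dot g x1 - \sum_i c i * dot (b i) x1.
exists (fun i => oapp c c0 (unlift ord0 i)) => [i|].
  case: unlift => //=; rewrite subr_ge0 (le_trans _ g_x1) //.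
  by apply: sumr_le0 => k _; rewrite mulr_ge0_le0.
rewrite big_ord_recl unlift_none /=.
under eq_bigr do rewrite liftK /=.
apply: (addIr (- (dot g x1 *: a ord0))); rewrite -/(proj g) cE.
rewrite scalerBl [RHS]addrC 2!addrA addNr add0r addrC scaler_suml -sumrB.
by apply: eq_bigr => i _; rewrite scalerBr scalerA.
Qed.


End Farkas.

(** Farkas' lemma for affine functionals, obtained by homogenization: the point
    [p i] with weight [h i] becomes a vector with one more coordinate. *)
Lemma farkas_affine {F : realFieldType} {d : nat} m (p : 'I_m -> 'rV[F]_d)
    (h : 'I_m -> F) q k :
  (forall u t, (forall i, dot u (p i) + t * h i <= 0) -> dot u q + t * k <= 0) ->
  exists c : 'I_m -> F, [/\ forall i, 0 <= c i,
    q = \sum_i c i *: p i & k = \sum_i c i * h i].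
Proof.
move=> imp; pose lift1 (v : 'rV[F]_d) s : 'rV_(d + 1) := row_mx v (const_mx s).
have dot_lift1 v s y : dot (lift1 v s) y = dot (lsubmx y) v + rsubmx y 0 0 * s.
  by rewrite -[y in LHS]hsubmxK dot_row_mx dotC [X in _ + X]big_ord1 mxE mulrC.
have [|c c_ge0 cE] := farkas (a := fun i => lift1 (p i) (h i)) (g := lift1 q k).
  by move=> y y_le0; rewrite dot_lift1 imp // => i; rewrite -dot_lift1.
exists c; split => //.
  apply/rowP => j; have /rowP/(_ (lshift 1 j)) := cE.
  rewrite row_mxEl !summxE => ->; apply: eq_bigr => i _.
  by rewrite [LHS]mxE [RHS]mxE row_mxEl.
have /rowP/(_ (rshift d 0)) := cE.
rewrite row_mxEr mxE summxE => ->.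
by apply: eq_bigr => i _; rewrite mxE row_mxEr mxE.
Qed.

(** * Convex hulls of finite families, faces and vertices *)

Section Hulls.
Context {R : realType} {d : nat}.
Implicit Types (A B P : set 'rV[R]_d) (u v x : 'rV[R]_d).

Definition convex_weights m (c : 'I_m -> R) :=
  (forall i, 0 <= c i) /\ \sum_i c i = 1.

Lemma convex_weights_neq0 m (c : 'I_m -> R) :
  convex_weights c -> exists i, c i != 0.
Proof.
case=> _ c1; apply/not_existsP => c0; have /eqP := c1.
rewrite big1 => [|i _]; first by rewrite eq_sym oner_eq0.
by apply/eqP/negPn/negP/c0.
Qed.

Lemma conv_weights m (p : 'I_m -> 'rV[R]_d) (c : 'I_m -> R) A :
  (forall i, A (p i)) -> convex_weights c -> conv A (\sum_i c i *: p i).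
Proof. by move=> Ap [c_ge0 c1]; exists m, p, c. Qed.

Lemma sub_conv A : A `<=` conv A.
Proof.
move=> x Ax; exists 1%N, (fun=> x), (fun=> 1).
by split => //; rewrite big_ord1 ?scale1r.
Qed.

Lemma convS A B : A `<=` B -> conv A `<=` conv B.
Proof.
move=> AB _ [m [p [c [Ap ? ? ->]]]].
by exists m, p, c; split=> // i; apply: AB.
Qed.

(** Used with [c l] concentrated at one index, to collect repeated points, and
    with general [c l], to show that convex hulls are convex. *)
Lemma convex_combine k m (p : 'I_m -> 'rV[R]_d) (b : 'I_k -> R)
    (c : 'I_k -> 'I_m -> R) :
  convex_weights b -> (forall l, convex_weights (c l)) ->
  convex_weights (fun i => \sum_l b l * c l i) /\
  \sum_l b l *: \sum_i c l i *: p i = \sum_i (\sum_l b l * c l i) *: p i.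
Proof.
move=> [b_ge0 b1] c_wt; split; first split.
- by move=> i; apply: sumr_ge0 => l _; rewrite mulr_ge0 //; case: (c_wt l).
- rewrite exchange_big -[RHS]b1; apply: eq_bigr => l _.
  by rewrite -mulr_sumr; case: (c_wt l) => _ ->; rewrite mulr1.
- under [RHS]eq_bigr do rewrite scaler_suml.
  rewrite [RHS]exchange_big; apply: eq_bigr => l _; rewrite scaler_sumr.
  by apply: eq_bigr => i _; rewrite scalerA.
Qed.

Lemma conv_range m (p : 'I_m -> 'rV[R]_d) x :
  conv (range p) x ->
  exists2 c : 'I_m -> R, convex_weights c & x = \sum_i c i *: p i.
Proof.
move=> [k [q [b [q_p b_ge0 b1 ->]]]].
have /choice[f fE] l : exists i, p i = q l by case: (q_p l) => i _ <-; exists i.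
have [||wt E] := @convex_combine k m p b (fun l i => (i == f l)%:R).
- by split.
- move=> l; split=> [i|]; first exact: ler0n.
  by rewrite (bigD1 (f l)) //= eqxx big1 ?addr0 // => i /negPf->.
eexists; first exact: wt.
rewrite -E; apply: eq_bigr => l _; rewrite (bigD1 (f l)) //= eqxx scale1r.
by rewrite big1 ?addr0 ?fE // => i /negPf->; rewrite scale0r.
Qed.

Lemma conv_min m (p : 'I_m -> 'rV[R]_d) A :
  A `<=` conv (range p) -> conv A `<=` conv (range p).
Proof.
move=> A_p _ [k [q [b [/(_ _)/A_p q_p b_ge0 b1 ->]]]].
have /choice[c cE] l : exists c : 'I_m -> R,
    convex_weights c /\ q l = \sum_i c i *: p i.
  by have [c ? ?] := conv_range (q_p l); exists c.
have [||wt E] := @convex_combine k m p b c; [by split|by move=> l; case: (cE l)|].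
under eq_bigr do rewrite (proj2 (cE _)).
by rewrite E; apply: conv_weights => // i; exists i.
Qed.

Lemma dot_conv_le A u b x :
  (forall y, A y -> dot u y <= b) -> conv A x -> dot u x <= b.
Proof.
move=> A_le [m [p [c [Ap c_ge0 c1 ->]]]]; rewrite dot_sumr -[b]mul1r -c1 mulr_suml.
by apply: ler_sum => i _; rewrite dotZr ler_wpM2l ?A_le.
Qed.

(** If a convex combination attains the maximum of a linear functional, so does
    every point that has a nonzero weight in it. *)
Lemma convex_weights_tight m (p : 'I_m -> 'rV[R]_d) (c : 'I_m -> R) u b :
  convex_weights c -> (forall i, c i != 0 -> dot u (p i) <= b) ->
  dot u (\sum_i c i *: p i) = b -> forall i, c i != 0 -> dot u (p i) = b.
Proof.
move=> [c_ge0 c1] p_le; rewrite dot_sumr => ub i ci.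
have gap_ge0 k : true -> 0 <= c k * (b - dot u (p k)).
  have [->|ck] := eqVneq (c k) 0; first by rewrite mul0r.
  by rewrite mulr_ge0 // subr_ge0 p_le.
have /eqP : \sum_k c k * (b - dot u (p k)) = 0.
  under eq_bigr do rewrite mulrBr.
  rewrite sumrB -mulr_suml c1 mul1r -[X in X - _]ub -sumrB big1 // => k _.
  by rewrite dotZr subrr.
rewrite psumr_eq0 // => /allP/(_ i); rewrite mem_index_enum => /(_ isT).
by rewrite mulf_eq0 (negPf ci) subr_eq0 => /eqP.
Qed.

Lemma separate_from_conv m (p : 'I_m -> 'rV[R]_d) x :
  ~ conv (range p) x ->
  exists u b, (forall i, dot u (p i) <= b) /\ b < dot u x.
Proof.
move=> x_p; apply: contrapT => no_sep; apply: x_p.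
have [|c [c_ge0 xE c1]] := @farkas_affine R d m p (fun=> 1) x 1.
  move=> u t le0; rewrite leNgt; apply/negP => gt0; apply: no_sep.
  exists u, (- t); split=> [i|]; first by have := le0 i; lra.
  by move: gt0; lra.
rewrite xE; apply: conv_weights => [i|]; first by exists i.
by split=> //; rewrite c1; apply: eq_bigr => i _; rewrite mulr1.
Qed.

(** If the other points do not already generate [p i], a functional separating
    it from them exposes it as a vertex. *)
Lemma vertex_drop m (p : 'I_m.+1 -> 'rV[R]_d) i :
  ~ vertices (conv (range p)) (p i) ->
  conv (range p) = conv (range (p \o lift i)).
Proof.
move=> not_vertex; apply/seteqP; split; last first.
  by apply: convS => _ [k _ <-]; exists (lift i k).
suff pi_conv : conv (range (p \o lift i)) (p i).
  apply: conv_min => _ [k _ <-].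
  case: (unliftP i k) => [l ->|->] //; apply: sub_conv; by exists l.
apply: contrapT => /separate_from_conv[u [b [p_le b_lt]]]; apply: not_vertex.
have p_le' k : dot u (p k) <= dot u (p i).
  by case: (unliftP i k) => [l ->|-> //]; rewrite (le_trans (p_le l)) ?ltW.
exists u, (dot u (p i)); split.
  by move=> x; apply: dot_conv_le => _ [k _ <-].
apply/seteqP; split=> [_ ->|x []].
  by split=> //; apply: sub_conv; exists i.
move=> /conv_range[c wt ->] ux.
have tight := convex_weights_tight wt (fun k _ => p_le' k) ux.
transitivity (\sum_k c k *: p i); last by rewrite -scaler_suml (proj2 wt) scale1r.
apply: eq_bigr => k _; have [->|/tight] := eqVneq (c k) 0; first by rewrite !scale0r.
case: (unliftP i k) => [l ->|-> //] upl.
by have := p_le l; rewrite /= upl leNgt b_lt.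
Qed.

(** By induction on the size of the family, points that are not vertices are
    dropped one at a time. *)
Lemma conv_vertices m (p : 'I_m -> 'rV[R]_d) P :
  P = conv (range p) ->
  exists l (q : 'I_l -> 'rV[R]_d),
    P = conv (range q) /\ forall i, vertices P (q i).
Proof.
elim: m p => [|m IHm] p PE; first by exists 0%N, p; split=> // -[].
have [|/existsNP[i not_vertex]] := pselect (forall i, vertices P (p i)).
  by exists m.+1, p.
by apply: (IHm (p \o lift i)); rewrite PE -vertex_drop // -PE.
Qed.

Lemma polytope_vertices P : polytope P ->
  exists l (q : 'I_l -> 'rV[R]_d),
    P = conv (range q) /\ forall i, vertices P (q i).
Proof.
move=> [s ->]; apply: (@conv_vertices (size s) (fun i => nth 0 s i)).
congr conv; apply/seteqP; split=> [x /= xs|_ [i _ <-]]; last exact: mem_nth.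
have si : (index x s < size s)%N by rewrite index_mem.
by exists (Ordinal si) => //=; rewrite nth_index.
Qed.

(** The functional that defines a face can only reach twice its maximum on
    [x' + y'] if both terms are in the face. *)
Lemma face_midpoint P E x y x' y' : face P E -> E x -> E y -> P x' -> P y' ->
  x + y = x' + y' -> E x' /\ E y'.
Proof.
move=> [u [b [le_b ->]]] [_ ux] [_ uy] Px' Py' /(congr1 (dot u)).
rewrite !dotDr; have := le_b _ Px'; have := le_b _ Py'.
move: ux uy; rewrite /= -!/(dot u _) => -> -> ? ? ?.
by split; split=> //; rewrite -/(dot u _); lra.
Qed.

End Hulls.

(** * Binomials of the toric ideal *)

Lemma prod_exprz (I : finType) (F : fieldType) (x : F) (z : I -> int) : x != 0 ->
  \prod_i x ^ z i = x ^ (\sum_i z i).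
Proof.
move=> x0; symmetry; apply: (big_morph (fun k : int => x ^ k)) => [k l|];
  by [rewrite expfzDr|rewrite expr0z].
Qed.

Lemma mpolyX_inj (R : nzRingType) k :
  injective (fun m : 'X_{1..k} => 'X_[m] : {mpoly R[k]}).
Proof. by move=> m1 m2 /(congr1 (@msupp k R)); rewrite /= !msuppX => -[]. Qed.

Section ToricMonomials.
Context {K : fieldType} {d n : nat} (a : 'I_n -> 'rV[int]_d).
Implicit Types m : 'X_{1..n}.

(** The exponent of [t] in the image of the monomial [m]. *)
Definition lattice_sum m : 'rV[int]_d := \sum_i a i *+ m i.

Lemma lattice_sum_pair i j : lattice_sum (U_(i) + U_(j)) = a i + a j.
Proof.
have sum1 k : \sum_s a s *+ U_(k)%MM s = a k.
  rewrite (bigD1 k) //= mnm1E eqxx mulr1n big1 ?addr0 // => s sk.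
  by rewrite mnm1E eq_sym (negPf sk) mulr0n.
by rewrite -[in RHS](sum1 i) -(sum1 j) -big_split; apply: eq_bigr => s _;
  rewrite mnmDE mulrnDr.
Qed.

Lemma ratS_neq0 : ratS K d != 0.
Proof. by rewrite tofrac_eq0 -msupp_eq0 msuppX. Qed.

Lemma toric_map_monomial m :
  laurent_val (toric_map a 'X_[m]) =
  \prod_j ratT K j ^ lattice_sum m 0 j * ratS K d ^+ mdeg m.
Proof.
rewrite /toric_map mmapX /mmap1.
rewrite -[LHS]/(val _) rmorph_prod.
under eq_bigr do rewrite rmorphXn /= exprMn -prodrXl.
rewrite big_split /= prodrXr -mdegE exchange_big; congr (_ * _).
apply: eq_bigr => j _; rewrite summxE -prod_exprz ?ratT_neq0 //.
by apply: eq_bigr => i _; rewrite mulmxnE -mulr_natr natz -exprz_exp.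
Qed.

Lemma prod_ratT_nat (p : 'I_d -> nat) :
  \prod_j ratT K j ^+ p j =
  FracField.tofrac 'X_[(\sum_j U_(widen_ord (leqnSn d) j) *+ p j)%MM].
Proof.
rewrite (big_morph (@mpolyX d.+1 K) (@mpolyXD _ _) (mpolyX0 _ _)) rmorph_prod.
apply: eq_bigr => j _.
by rewrite -mpolyXn rmorphXn.
Qed.

Lemma prod_ratT_inj (z z' : 'I_d -> int) :
  \prod_j ratT K j ^ z j = \prod_j ratT K j ^ z' j -> z =1 z'.
Proof.
(* Multiplying by [T_j ^+ N j] makes all the exponents nonnegative, which brings
   the equation back to monomials of the polynomial ring. *)
pose N j := (`|z j| + `|z' j|)%N.
have shift (y : 'I_d -> int) : (forall j, `|y j| <= N j)%N ->
    \prod_j ratT K j ^ y j * \prod_j ratT K j ^+ N j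
    = \prod_j ratT K j ^+ absz (y j + N j).
  move=> y_le; rewrite -big_split; apply: eq_bigr => j _ /=.
  rewrite [RHS]exprnP gez0_abs ?expfzDr ?ratT_neq0 //.
  by have := y_le j; lia.
move=> /(congr1 ( *%R^~ (\prod_j ratT K j ^+ N j))).
rewrite /= !shift => [|j|j]; rewrite ?leq_addr ?leq_addl //.
rewrite !prod_ratT_nat => /eqP; rewrite tofrac_eq => /eqP/mpolyX_inj/mnmP mE j.
have := mE (widen_ord (leqnSn d) j).
rewrite !mnm_sumE (bigD1 j) //= [in X in _ = X -> _](bigD1 j) //=.
rewrite !mulmnE !mnm1E !eqxx !mul1n !big1 ?addn0 => [|i /negPf ij|i /negPf ij].
- by rewrite /N; lia.
- by rewrite mulmnE mnm1E -val_eqE /= val_eqE ij.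
- by rewrite mulmnE mnm1E -val_eqE /= val_eqE ij.
Qed.

Lemma toric_binomialP m1 m2 : mdeg m1 = mdeg m2 ->
  toric_ideal K a ('X_[m1] - 'X_[m2]) <-> lattice_sum m1 = lattice_sum m2.
Proof.
move=> degE; rewrite /toric_ideal /= /toric_map rmorphB /= -/(toric_map a _).
rewrite -[mmap _ _ 'X_[m2]]/(toric_map a _); split=> [/eqP|wE].
  rewrite subr_eq0 => /eqP/(congr1 val).
  rewrite /= !toric_map_monomial degE => /mulIf E.
  apply/rowP => j; apply: (prod_ratT_inj (E _)).
  by rewrite expf_neq0 ?ratS_neq0.
apply/eqP; rewrite subr_eq0; apply/eqP/val_inj.
by rewrite /= !toric_map_monomial degE wE.
Qed.

End ToricMonomials.

(** * Monomials absent from an ideal generated by quadratic binomials *)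

Lemma mcoeff_mulX_eq0 (R : nzRingType) n (c : {mpoly R[n]}) (m k : 'X_{1..n}) :
  ~~ (k <= m)%MM -> (c * 'X_[k])@_m = 0.
Proof.
move=> km; rewrite [c]mpolyE mulr_suml raddf_sum big1 //= => l _.
rewrite -scalerAl -mpolyXD mcoeffZ mcoeffX; case: eqP => [lk|]; last by rewrite mulr0.
by case/negP: km; rewrite -lk lem_addl.
Qed.

Lemma mdeg2P n (m : 'X_{1..n}) : mdeg m = 2%N -> exists i j, m = (U_(i) + U_(j))%MM.
Proof.
move=> m2; have /existsP[i mi] : [exists i, m i != 0%N].
  apply/existsPn => m0; suff : mdeg m = 0%N by rewrite m2.
  by rewrite mdegE big1 // => i _; apply/eqP/negPn/m0.
have Ui : (U_(i) <= m)%MM by rewrite lep1mP.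
have /mdeg1P[j /eqP E] : mdeg (m - U_(i)) == 1%N.
  by rewrite -(eqn_add2r (mdeg U_(i)%MM)) -mdegD submK // m2 mdeg1.
by exists j, i; rewrite -E submK.
Qed.

(** No multiple of a generator [g = X^m1 - X^m2] has the monomial [m]: for this
    [m1] or [m2] would have to divide [m], and then [m1 = m2]. *)
Lemma quadratic_ideal_coeff0 (K : fieldType) n (I : set {mpoly K[n]}) (m : 'X_{1..n}) :
  quadratic_ideal I ->
  (forall m1 m2, mdeg m1 = 2%N -> mdeg m2 = 2%N -> (m1 <= m)%MM ->
     I ('X_[m1] - 'X_[m2]) -> m1 = m2) ->
  forall f, I f -> f@_m = 0.
Proof.
move=> [G [G_quad IE]] m_rigid f; rewrite IE => -[k [c [g [Gg ->]]]].
have GI h : G h -> I h.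
  by move=> Gh; rewrite IE; exists 1%N, (fun=> 1), (fun=> h); rewrite big_ord1 mul1r.
rewrite raddf_sum big1 //= => l _.
have [[m1 [m2 [m12 gE]]] g_hom] := G_quad _ (Gg l).
have Ig := GI _ (Gg l); move: g_hom Ig; rewrite gE => /dhomogP g_hom Ig.
have coeff_neq0 (k1 k2 : 'X_{1..n}) : k1 <> k2 ->
    ('X_[k1] - 'X_[k2] : {mpoly K[n]})@_k1 != 0.
  by move=> /nesym/eqP/negPf k12; rewrite mcoeffB !mcoeffX eqxx k12 subr0 oner_eq0.
have deg1 : mdeg m1 = 2%N by apply: g_hom; rewrite mcoeff_msupp coeff_neq0.
have deg2 : mdeg m2 = 2%N.
  apply: g_hom; rewrite -opprB (perm_mem (msuppN _)) mcoeff_msupp.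
  exact/coeff_neq0/nesym.
rewrite mulrBr mcoeffB !mcoeff_mulX_eq0 ?subr0 //; apply/negP => le_m.
  have IN : I ('X_[m2] - 'X_[m1]).
    move: Ig; rewrite IE => -[k' [c' [g' [Gg' E]]]].
    exists k', (fun i => - c' i), g'; split => //.
    by rewrite -opprB E -sumrN; apply: eq_bigr => i _; rewrite mulNr.
  by apply: m12; rewrite (m_rigid _ _ deg2 deg1 le_m IN).
by apply: m12; apply: m_rigid.
Qed.

(** * Separating functionals or binomial relations *)

Lemma clear_denominators n (c : 'I_n -> rat) : (forall i, 0 <= c i) ->
  exists (N : nat) (L : 'I_n -> nat),
    (0 < N)%N /\ forall i, c i * N%:R = (L i)%:R.
Proof.
move=> c_ge0; pose D i := absz (denq (c i)).
have D_gt0 i : (0 < D i)%N by rewrite absz_gt0 denq_neq0.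
exists (\prod_i D i)%N, (fun i => absz (numq (c i)) * \prod_(j | j != i) D j)%N.
split=> [|i]; first by rewrite prodn_gt0.
rewrite (bigD1 i) //= !natrM mulrA; congr (_ * _).
rewrite !natr_absz !ger0_norm ?numq_ge0 ?denq_ge0 //.
by rewrite numqE.
Qed.

Lemma intr_row_inj (F : numDomainType) d :
  injective (fun z : 'rV[int]_d => map_mx intr z : 'rV[F]_d).
Proof.
move=> x y /rowP E; apply/rowP => j.
by have := E j; rewrite !mxE => /intr_inj.
Qed.

(** Farkas' lemma is applied over the rationals rather than the reals, so that
    its coefficients can be turned into exponents. *)
Definition rat_pt d (z : 'rV[int]_d) : 'rV[rat]_d := map_mx intr z.

Lemma rat_pt_lattice_sum d n (a : 'I_n -> 'rV[int]_d) m :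
  rat_pt (lattice_sum a m) = \sum_i (m i)%:R *: rat_pt (a i).
Proof.
rewrite /rat_pt raddf_sum; apply: eq_bigr => i _ /=.
by rewrite raddfMn scaler_nat.
Qed.

(** Farkas' alternative for the vectors [(a i, 1)] together with minus the sum of
    those with [J i], and the target [- (a w, 1)].  The extra generator forces
    equality along [J], because all the other generators are on the nonpositive
    side.  A representation of the target rearranges to
    [c0 * \sum_(j | J j) (a j, 1) = (a w, 1) + \sum_i c i * (a i, 1)]. *)
Lemma separate_or_relation d n (a : 'I_n -> 'rV[int]_d) (J : pred 'I_n) w :
  (exists u t, [/\ forall i, dot u (rat_pt (a i)) <= t,
      forall i, J i -> dot u (rat_pt (a i)) = t & dot u (rat_pt (a w)) < t]) \/
  (exists m m' : 'X_{1..n}, [/\ forall i, ~~ J i -> m i = 0%N, (0 < m' w)%N,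
      mdeg m = mdeg m' & lattice_sum a m = lattice_sum a m']).
Proof.
have [sep|no_sep] := pselect (exists u t,
  [/\ forall i, dot u (rat_pt (a i)) <= t,
      forall i, J i -> dot u (rat_pt (a i)) = t & dot u (rat_pt (a w)) < t]);
  [by left|right].
pose q i := rat_pt (a i).
pose p (i : 'I_n.+1) := oapp q (- \sum_(j | J j) q j) (unlift ord0 i).
pose h (i : 'I_n.+1) : rat := oapp (fun=> 1) (- \sum_(j | J j) 1) (unlift ord0 i).
have [|c [c_ge0 qE hE]] := farkas_affine (p := p) (h := h) (q := - q w) (k := -1).
  move=> u t ph_le0; rewrite leNgt; apply/negP => w_gt0; apply: no_sep.
  have q_le0 i : dot u (q i) + t <= 0.
    by have := ph_le0 (lift ord0 i); rewrite /p /h liftK /= mulr1.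
  exists u, (- t); split=> [i|i Ji|]; first by have := q_le0 i; rewrite -/(q _); lra.
    have := ph_le0 ord0; rewrite /p /h unlift_none /= dotNr big_mkcond dot_sumr mulrN.
    rewrite mulr_sumr -opprD oppr_le0 [in X in _ + X]big_mkcond -big_split /=.
    rewrite (bigD1 i) //= Ji mulr1 => sum_ge0.
    have rest_le0 : \sum_(k | k != i) (dot u (if J k then q k else 0) +
        (if J k then t else 0)) <= 0.
      by apply: sumr_le0 => k _; case: (J k); rewrite ?dotr0 ?addr0.
    by have := q_le0 i; rewrite -/(q i); lra.
  by move: w_gt0; rewrite dotNr -/(q w); lra.
have [N [L [N_gt0 LE]]] := clear_denominators c_ge0.
pose m := [multinom (if J i then L ord0 else 0%N) | i < n].
pose m' := [multinom ((i == w) * N + L (lift ord0 i))%N | i < n].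
move: qE hE; rewrite !big_ord_recl /p /h unlift_none /=.
under [X in _ = _ + X -> _]eq_bigr do rewrite liftK /=.
move=> qE; under [X in _ = _ + X -> _]eq_bigr do rewrite liftK /= mulr1.
move=> hE.
(* The relation is needed for the points and for their weights 1, hence in two
   spaces [V]. *)
have scaled (V : lmodType rat) (f : 'I_n -> V) :
    - f w = c ord0 *: - (\sum_(j | J j) f j) + \sum_i c (lift ord0 i) *: f i ->
    \sum_i (m i)%:R *: f i = \sum_i (m' i)%:R *: f i.
  move=> E; transitivity (N%:R *: (c ord0 *: \sum_(j | J j) f j)).
    rewrite scalerA scaler_sumr [RHS]big_mkcond; apply: eq_bigr => i _.
    by rewrite mnmE; case: (J i); rewrite ?scale0r // mulrC LE.
  have -> : c ord0 *: (\sum_(j | J j) f j) = f w + \sum_i c (lift ord0 i) *: f i.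
    by rewrite -[f w]opprK E scalerN opprD opprK subrK.
  rewrite scalerDr scaler_sumr.
  under [RHS]eq_bigr do rewrite mnmE natrD scalerDl.
  rewrite [RHS]big_split [X in _ = X + _](bigD1 w) //= eqxx mul1n.
  rewrite [X in _ = _ + X + _]big1 ?addr0 => [|i /negPf->].
    by congr (_ + _); apply: eq_bigr => i _; rewrite scalerA mulrC LE.
  by rewrite mul0n scale0r.
exists m, m'; split.
- by move=> i /negPf Ji; rewrite mnmE Ji.
- by rewrite mnmE eqxx mul1n; lia.
- apply/eqP; rewrite -(eqr_nat rat) !mdegE !natr_sum; apply/eqP.
  transitivity (\sum_i (m i)%:R *: (1 : rat^o)).
    by apply: eq_bigr => i _; rewrite [RHS]mulr1.
  rewrite scaled; first by apply: eq_bigr => i _; rewrite [LHS]mulr1.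
  apply: (etrans hE); congr (_ + _).
  by apply: eq_bigr => i _; rewrite [RHS]mulr1.
- by apply: (@intr_row_inj rat); rewrite -!/(rat_pt _) !rat_pt_lattice_sum; apply: scaled.
Qed.

(** * Lattice points of the edges between members of a clique *)

(** A pair of members of a clique spans a vertex or a primitive edge of [P], and
    in both cases two lattice points of [P] with the same midpoint are in it. *)
Lemma edge_sum_unique (R : realType) d (P : set 'rV[R]_d)
    (Hprim : forall E : set 'rV[R]_d, edge P E -> primitive_segment E)
    (C : set 'rV[R]_d) (x y x' y' : 'rV[int]_d) :
  sk_clique P C -> C (lattice_pt x) -> C (lattice_pt y) ->
  P (lattice_pt x') -> P (lattice_pt y') -> x + y = x' + y' ->
  (x' = x /\ y' = y) \/ (x' = y /\ y' = x).
Proof.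
move=> [C_vert C_adj] Cx Cy Px' Py' xy.
have xyR : lattice_pt x + lattice_pt y = lattice_pt x' + lattice_pt y' :> 'rV[R]_d.
  by rewrite -!raddfD xy.
have [xE|x_neq_y] := eqVneq x y.
  left; rewrite -xE in xyR *; have v : [set lattice_pt x] (lattice_pt x : 'rV[R]_d) by [].
  by have [/(@intr_row_inj R)-> /(@intr_row_inj R)->] :=
    face_midpoint (C_vert _ Cx) v v Px' Py' xyR.
have [|_ _ _ edge_xy] := C_adj _ _ Cx Cy.
  by move/(@intr_row_inj R)/eqP; rewrite (negPf x_neq_y).
set E := conv _ in edge_xy.
have [Ex Ey] : E (lattice_pt x) /\ E (lattice_pt y).
  by split; apply: sub_conv; [left|right].
have [Ex' Ey'] := face_midpoint (proj1 edge_xy) Ex Ey Px' Py' xyR.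
have [y1 [z1 [_ _ latE]]] := Hprim _ edge_xy.
have lat z : E (lattice_pt z) -> z = y1 \/ z = z1.
  by move=> Ez; have : lattice_points E z by []; rewrite latE.
have x'_end : x' = x \/ x' = y.
  move: x_neq_y => /eqP; case: (lat _ Ex); case: (lat _ Ey); case: (lat _ Ex');
  move=> -> -> -> //; tauto.
case: x'_end => x'E; [left|right]; split=> //; move: xy; rewrite x'E.
  by move/addrI.
by rewrite [x + y]addrC => /addrI.
Qed.

(** * The theorem *)

Theorem theorem1p1 (R : realType) (K : fieldType) (d : nat)
    (P : set 'rV[R]_d) (HP : lattice_polytope P)
    (Hprim : forall E : set 'rV[R]_d, edge P E -> primitive_segment E)
    (n : nat) (a : 'I_n -> 'rV[int]_d) (a_inj : injective a)
    (a_enum : range a = lattice_points P)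
    (Hquad : quadratic_ideal (toric_ideal K a)) :
  forall C : set 'rV[R]_d, sk_clique P C ->
    exists F : set 'rV[R]_d, face P F /\ vertices F = C.
Proof.
move=> C C_clique; have [C_vert _] := C_clique.
pose pt i : 'rV[R]_d := lattice_pt (a i).
have Ppt i : P (pt i).
  by have : lattice_points P (a i) by rewrite -a_enum; exists i.
have vertex_pt v : vertices P v -> exists i, pt i = v.
  move=> vP; have [z zE] := HP.2 _ vP.
  have [i _ iE] : range a z.
    rewrite a_enum /lattice_points /= -zE.
    case: vP => u [b [_ E]]; have : [set v] v by [].
    by rewrite E => -[].
  by exists i; rewrite /pt iE.
have P_hull : P = conv (range pt).
  have [l [q [PE q_vert]]] := polytope_vertices HP.1.
  apply/seteqP; split; last first.
    by rewrite PE; apply: conv_min => _ [i _ <-]; rewrite -PE.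
  rewrite [X in X `<=` _]PE; apply: convS => _ [i _ <-].
  by have [k <-] := vertex_pt _ (q_vert i); exists k.
pose J i := `[< C (pt i) >].
(* No quadratic binomial of the ideal applies to a monomial supported on the
   clique. *)
have clique_monomial_absent (m : 'X_{1..n}) : (forall i, ~~ J i -> m i = 0%N) ->
    forall f, toric_ideal K a f -> f@_m = 0.
  move=> m_supp; apply: (quadratic_ideal_coeff0 Hquad) => m1 m2 deg1 deg2 le_m.
  move=> /(proj1 (toric_binomialP _ (etrans deg1 (esym deg2)))).
  have [i [j m1E]] := mdeg2P deg1; have [k [l m2E]] := mdeg2P deg2.
  have C_supp s : (0 < m1 s)%N -> C (pt s).
    move=> m1s; apply/asboolP; apply: contraLR m1s => /m_supp ms.
    by have := mnm_lepP le_m s; rewrite ms -leqNgt.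
  rewrite m1E m2E !lattice_sum_pair => aE.
  have Ci : C (pt i) by apply: C_supp; rewrite m1E mnmDE mnm1E eqxx.
  have Cj : C (pt j) by apply: C_supp; rewrite m1E mnmDE [U_(j)%MM _]mnm1E eqxx addn1.
  have [[/a_inj-> /a_inj->]|[/a_inj-> /a_inj->]] // :=
    edge_sum_unique Hprim C_clique Ci Cj (Ppt k) (Ppt l) aE.
  by rewrite addmC.
have /choice[ut utE] (w : 'I_n) : exists ut : 'rV[rat]_d * rat,
    [/\ forall i, dot ut.1 (rat_pt (a i)) <= ut.2,
      forall i, J i -> dot ut.1 (rat_pt (a i)) = ut.2 &
      ~~ J w -> dot ut.1 (rat_pt (a w)) < ut.2].
  have [Jw|Jw] := boolP (J w).
    by exists (0, 0); split=> [i|i _|]; rewrite ?Jw //= dotC dotr0 ?lexx.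
  have [[u [t [? ? ?]]]|[m [m' [m_supp m'w degE sumE]]]] :=
    separate_or_relation a J w; first by exists (u, t).
  have := proj2 (toric_binomialP (K := K) a degE) sumE.
  move=> /(clique_monomial_absent m m_supp).
  rewrite mcoeffB !mcoeffX eqxx; case: eqP => [m'E|_].
    by move: m'w; rewrite m'E m_supp.
  by rewrite subr0 => /eqP; rewrite oner_eq0.
(* In the sum, the functional for [w] makes the inequality at [w] strict. *)
pose uq := \sum_w (ut w).1; pose bq := \sum_w (ut w).2.
pose u : 'rV[R]_d := map_mx ratr uq; pose b : R := ratr bq.
have u_pt i : dot u (pt i) = ratr (dot uq (rat_pt (a i))).
  rewrite /dot rmorph_sum; apply: eq_bigr => j _.
  by rewrite rmorphM /pt /lattice_pt /rat_pt !mxE /= ratr_int.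
have u_le i : dot u (pt i) <= b.
  rewrite u_pt ler_rat dot_suml; apply: ler_sum => w _.
  by case: (utE w).
have u_eq i : dot u (pt i) = b <-> J i.
  rewrite u_pt; split=> [|Ji]; last first.
    congr ratr; rewrite dot_suml; apply: eq_bigr => w _.
    by case: (utE w) => _ /(_ _ Ji)->.
  apply: contraPT => Ji; apply/eqP; rewrite lt_eqF // ltr_rat dot_suml.
  rewrite (bigD1 i) //= [X in _ < X](bigD1 i) //=.
  apply: ltr_leD; first by case: (utE i) => _ _; apply.
  by apply: ler_sum => w _; case: (utE w).
pose F := [set x | P x /\ dot u x = b].
have Fpt i : J i -> F (pt i) by move=> /u_eq.
exists F; split.
  exists u, b; split=> // x; rewrite [in P x]P_hull.
  by apply: dot_conv_le => _ [i _ <-].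
apply/seteqP; split=> [v|v Cv].
  move=> [u' [b' [F_le vE]]].
  have [Fv u'v] : F v /\ dot u' v = b' by have : [set v] v by []; rewrite vE.
  (* Equality at [v] forces equality at every lattice point used to write [v],
     for [u] and then for [u']: these points are in the clique, and equal [v]. *)
  have [Pv uv] := Fv; move: (Pv); rewrite P_hull => /conv_range[c wt v_sum].
  have J_supp i : c i != 0 -> J i.
    move=> ci; apply/u_eq; rewrite v_sum in uv.
    exact: (convex_weights_tight wt _ uv).
  have [i ci] := convex_weights_neq0 wt.
  have : [set v] (pt i).
    rewrite vE; split; [exact/Fpt/J_supp|rewrite -/(dot u' _)].
    rewrite v_sum in u'v; apply: (convex_weights_tight wt _ u'v ci) => k ck.
    exact/F_le/Fpt/J_supp.
  by move=> <-; apply/asboolP; exact: J_supp.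
have [u' [b' [P_le vE]]] := C_vert _ Cv.
have [i iE] := vertex_pt _ (C_vert _ Cv).
have Fv : F v by rewrite -iE; apply: Fpt; apply/asboolP; rewrite iE.
exists u', b'; split=> [x [Px _]|]; first exact: P_le.
apply/seteqP; split=> [x xv|x [[Px _] ux]]; last by rewrite vE.
by split; [rewrite xv|move: xv; rewrite vE => -[]].
Qed.
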